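(* Let $X=\{p\}\,\dot\cup\,{}^{\le\omega}\omega$ be the one-point compactification (with added point $p$) of the space ${}^{\le\omega}\omega$ topologized as follows: every point of ${}^{<\omega}\omega$ is isolated, and the basic neighbourhoods of $f\in{}^{\omega}\omega$ are the sets $\{f\}\cup\{f\upharpoonright j: j\in\omega\setminus k\}$ for $k\in\omega$. Then player Two has a winning strategy in the game $\mathsf{G}_2(\Omega_p,\Omega_p)$ on $X$.
   Context: ${}^{<\omega}\omega$ is the set of all finite sequences of elements of $\omega$, and ${}^{\le\omega}\omega=({}^{<\omega}\omega)\cup({}^{\omega}\omega)$. For a space $X$ and $x\in X$, let $\Omega_x=\{A\subseteq X: x\in\overline{A}\}$. The game $\mathsf{G}_2(\Omega_x,\Omega_x)$ on $X$ is played by One and Two: in each inning $n\in\omega$, One chooses $A_n\in\Omega_x$, and then Two selects $F_n\subseteq A_n$ with $|F_n|\le 2$. Two wins if $\bigcup_{n\in\omega}F_n\in\Omega_x$; otherwise One wins. *)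

(* Defs.v *)
From HB Require Import structures.
From mathcomp Require Import all_boot all_classical topology.

Set Implicit Arguments.
Unset Strict Implicit.
Unset Printing Implicit Defensive.

Local Open Scope classical_set_scope.
Local Open Scope card_scope.

(* ^{<=omega}omega: [inl s] is a finite sequence, [inr f] an infinite one.
   The restriction of f to {0, ..., j-1} is [mkseq f j]. *)
Definition omega_tree : Type := (seq nat + (nat -> nat))%type.

HB.instance Definition _ := Choice.on omega_tree.

Definition omega_tree_basic (f : nat -> nat) (k : nat) : set omega_tree :=
  [set inr f] `|` [set inl (mkseq f j) | j in [set j | (k <= j)%N]].

Definition omega_tree_nbhs (x : omega_tree) : set_system omega_tree :=
  match x with
  | inl s => principal_filter (inl s : omega_tree)
  | inr f => filter_from setT (omega_tree_basic f)
  end.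

Lemma omega_tree_nbhs_filter (x : omega_tree) :
  ProperFilter (omega_tree_nbhs x).
Proof.
case: x => [s|f] /=; first exact: principal_filter_proper.
apply: filter_from_proper; last by move=> k _; exists (inr f); left.
apply: filter_from_filter; first by exists 0.
move=> i j _ _; exists (maxn i j) => // y [->|[l /= + <-]].
  by split; left.
by rewrite geq_max => /andP[il jl]; split; right; exists l.
Qed.

Lemma omega_tree_nbhs_singleton (x : omega_tree) (A : set omega_tree) :
  omega_tree_nbhs x A -> A x.
Proof.
case: x => [s|f] /=; first by move/principal_filterP.
by move=> [k _]; apply; left.
Qed.

Lemma omega_tree_nbhs_nbhs (x : omega_tree) (A : set omega_tree) :
  omega_tree_nbhs x A -> omega_tree_nbhs x (omega_tree_nbhs^~ A).
Proof.
case: x => [s|f] /=; first by move=> sA; apply/principal_filterP.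
move=> [k _ kA]; exists k => // y [->|[l /= kl <-]]; first by exists k.
by apply/principal_filterP; apply: kA; right; exists l.
Qed.

HB.instance Definition _ := hasNbhs.Build omega_tree omega_tree_nbhs.
HB.instance Definition _ := @Nbhs_isNbhsTopological.Build omega_tree
  omega_tree_nbhs_filter omega_tree_nbhs_singleton omega_tree_nbhs_nbhs.

Definition Omega (X : topologicalType) (x : X) : set (set X) :=
  [set A | closure A x].

(* A strategy for Two in a selection game on the set T returns Two's answer in
   inning n from One's moves A_0, ..., A_n, listed in this order. *)
Definition two_strategy (T : Type) : Type := seq (set T) -> set T.

Definition two_answer (T : Type) (sigma : two_strategy T) (A : nat -> set T)
  (n : nat) : set T := sigma (mkseq A n.+1).

(* sigma is winning for Two in G_k(P, Q): against every run of legal moves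
   A_n in P of One, all answers F_n of sigma are legal, i.e., F_n is a subset
   of A_n with at most k elements, and the union of the F_n is in Q. *)
Definition two_winning (T : Type) (k : nat) (P Q : set (set T))
    (sigma : two_strategy T) : Prop :=
  forall A : nat -> set T, (forall n, P (A n)) ->
    (forall n, two_answer sigma A n `<=` A n /\ two_answer sigma A n #<= `I_k) /\
    Q (\bigcup_n two_answer sigma A n).

Definition two_has_winning_strategy (T : Type) (k : nat)
    (P Q : set (set T)) : Prop :=
  exists sigma : two_strategy T, two_winning k P Q sigma.

(* Main.v *)
From HB Require Import structures.
Require Import Defs.
From mathcomp Require Import all_boot all_classical topology.

(** Call "branch of f" the set consisting of f and all its restrictions.
    Branches are compact, open and closed, and they cover the tree, so a set A
    of tree points accumulates at p iff no finite family of branches covers A;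
    it suffices for this that A contains arbitrarily large finite antichains
    (sets of points no two of which share a branch).
    Two maintains a finite antichain C made of points already selected, and can
    enlarge it by one point in every inning: either some x in A is incomparable
    with all of C, and C + x is an antichain, or two incomparable points x, y
    of A lie above the same c in C, and C - c + x + y is an antichain.
    Otherwise every point of A lies below a point of C, or in one of the
    finitely many chains {x in A : x above c}, and A is covered by 2|C|
    branches. *)

Set Implicit Arguments.
Unset Strict Implicit.
Unset Printing Implicit Defensive.

Local Open Scope classical_set_scope.
Local Open Scope card_scope.

HB.instance Definition _ := isPointed.Build omega_tree (inl [::]).

(** * Branches and the tree order *)

Definition branch (f : nat -> nat) : set omega_tree := omega_tree_basic f 0.

(** The graph of x as a partial function, so that finite and infinite points are treated alike: a
    branch contains x when its function extends this graph. *)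
Definition entry (x : omega_tree) (n m : nat) : Prop :=
  match x with
  | inl s => (n < size s)%N /\ nth 0 s n = m
  | inr g => g n = m
  end.

Lemma branchP (f : nat -> nat) (x : omega_tree) :
  branch f x <-> forall n m, entry x n m -> f n = m.
Proof.
split.
  move=> [->|[j _ <-]] n m //= [].
  by rewrite size_mkseq => nj; rewrite nth_mkseq.
case: x => [s|g] /= h; last first.
  by left; congr inr; apply/funext => n; rewrite (h n (g n)).
right; exists (size s) => //; congr inl.
apply: (@eq_from_nth _ 0); rewrite size_mkseq // => i si.
by rewrite nth_mkseq // (h i (nth 0 s i)).
Qed.

Lemma branch_inr (f g : nat -> nat) : branch f (inr g) -> f = g.
Proof. by move=> [[]|[]]. Qed.

(** A finite sequence is padded with zeros. *)
Definition through (x : omega_tree) : nat -> nat :=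
  match x with inl s => nth 0 s | inr f => f end.

Lemma branch_through (x : omega_tree) : branch (through x) x.
Proof. by apply/branchP; case: x => [s|f] n m //= []. Qed.

Definition comparable (x y : omega_tree) : Prop :=
  exists f, branch f x /\ branch f y.

(** Amounts to x being an initial segment of y. *)
Definition below (x y : omega_tree) : Prop :=
  forall f, branch f y -> branch f x.

Lemma comparable_sym (x y : omega_tree) : comparable x y -> comparable y x.
Proof. by move=> [f [? ?]]; exists f. Qed.

Lemma comparable_refl (x : omega_tree) : comparable x x.
Proof. by exists (through x); split; apply: branch_through. Qed.

(** Finite points of one branch are ordered by length, and [inr f] lies on no branch but that of
    f. *)
Lemma comparable_below (x y : omega_tree) :
  comparable x y -> below x y \/ below y x.
Proof.
have mkseq_below (f : nat -> nat) i j : (i <= j)%N ->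
    below (inl (mkseq f i)) (inl (mkseq f j)).
  move=> ij g /branchP gj; apply/branchP => n m /= [].
  rewrite size_mkseq => ni; rewrite nth_mkseq // => <-; apply: gj.
  have nj := leq_trans ni ij.
  by rewrite /= size_mkseq nth_mkseq.
move=> [f [fx fy]].
case: (fx) => [xE|[i _ xE]]; first by right => g; rewrite xE => /branch_inr ->.
case: (fy) => [yE|[j _ yE]]; first by left => g; rewrite yE => /branch_inr ->.
by rewrite -xE -yE; case: (leqP i j) => [ij|/ltnW ij]; [left|right];
  apply: mkseq_below.
Qed.

Lemma comparable_belowW (c x y : omega_tree) :
  below c x -> comparable x y -> comparable c y.
Proof. by move=> cx [f [/cx fc fy]]; exists f. Qed.

(** Pairwise comparable points are compatible partial functions, so their union is again a function;
    it is completed by 0 where no point of S has an entry. *)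
Lemma chain_sub_branch (S : set omega_tree) :
  (forall x y, S x -> S y -> comparable x y) -> exists f, S `<=` branch f.
Proof.
move=> chS; pose V n : set nat := [set m | exists2 x, S x & entry x n m].
exists (fun n => xget 0 (V n)) => x Sx; apply/branchP => n m xnm.
have /(xgetPex 0)[y Sy ynm] : exists m, V n m by exists m, x.
have [g [/branchP gx /branchP gy]] := chS _ _ Sx Sy.
by rewrite -(gx _ _ xnm) (gy _ _ ynm).
Qed.

(** * Topology of branches *)

Lemma open_branch (f : nat -> nat) : open (branch f).
Proof.
rewrite openE => x [->|[j _ <-]]; first by exists 0.
by apply/principal_filterP; right; exists j.
Qed.

Lemma closed_branch (f : nat -> nat) : closed (branch f).
Proof.
rewrite -openC openE => -[s|g] /= fx; first exact/principal_filterP.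
have [n /eqP fgn] : exists n, f n <> g n.
  apply/existsNP => fg; apply: fx; left; congr inr.
  by apply/funext => n; rewrite fg.
(* Restrictions of g of length at least [n.+1] contain the entry at n, where f and g differ. *)
exists n.+1 => // y + fy; move: (fy) => /branchP fyP.
move=> [yE|[j /= nj yE]]; first by move: fgn; rewrite (fyP n (g n)) ?yE ?eqxx.
by move: fgn; rewrite (fyP n (g n)) ?eqxx // -yE /= size_mkseq nth_mkseq.
Qed.

(** If [inr f] is not a cluster point of F, some set in F misses a tail of the branch, so F contains
    a finite set of restrictions of f. *)
Lemma compact_branch (f : nat -> nat) : compact (branch f).
Proof.
move=> F PF Ff; have [fF|] := pselect (cluster F (inr f : omega_tree)).
  by exists (inr f); split=> //; left.
move=> /existsNP[A /existsNP[B /not_implyP[FA /not_implyP[[k _ kB] AB]]]].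
have finK : finite_set [set (inl (mkseq f j) : omega_tree) | j in `I_k].
  exact/finite_image/finite_II.
have FK : F [set (inl (mkseq f j) : omega_tree) | j in `I_k].
  apply: filterS (filterI FA Ff) => x [Ax fx].
  have nkx : ~ omega_tree_basic f k x by move=> /kB Bx; apply: AB; exists x.
  case: fx => [xE|[j _ xE]]; first by case: nkx; left.
  exists j => //=; rewrite ltnNge; apply/negP => kj.
  by apply: nkx; right; exists j.
have [x [[j _ xE] Fx]] := finite_compact finK PF FK.
by exists x; split=> //; right; exists j.
Qed.

Definition branch_coverable (A : set omega_tree) : Prop :=
  exists s : seq (nat -> nat), A `<=` \bigcup_(f in [set` s]) branch f.

Lemma compact_branch_coverable (K : set omega_tree) :
  compact K -> branch_coverable K.
Proof.
move=> cK; have : cover_compact K by rewrite -compact_cover.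
move=> /(_ _ setT branch)[f _||D _ KD].
- exact: open_branch.
- by move=> x _; exists (through x) => //; apply: branch_through.
- by exists (finmap.enum_fset D).
Qed.

Local Notation opc := (one_point_compactification omega_tree).

Lemma Omega_branch_coverable (A : set opc) :
  Omega (None : opc) A -> branch_coverable (Some @^-1` A) -> A None.
Proof.
move=> clA [s As]; pose K := \bigcup_(f in [set` s]) branch f.
have cK : compact K.
  rewrite /K bigcup_seq; elim/big_ind : _ => [|? ?|? _]; first exact: compact0.
    exact: compactU.
  exact: compact_branch.
have clK : closed K.
  by apply: closed_bigcup => [|f _]; [exact: finite_seq|exact: closed_branch].
(* Removing K leaves a neighbourhood of p, which A can meet only in p. *)
have [|x [Ax]] := clA (Some @` (~` K) `|` [set None]); first by exists K.
by move=> [[y Ky yx]|<-//]; case: Ky; apply: As; rewrite /= yx.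
Qed.

(** * Antichains *)

Definition antichain (C : seq omega_tree) : Prop :=
  uniq C /\ forall x y, x \in C -> y \in C -> comparable x y -> x = y.

(** A branch holds at most one point of an antichain, so choosing for each point a branch from s
    through it is injective. *)
Lemma leq_size_antichain (C : seq omega_tree) (s : seq (nat -> nat)) :
  antichain C -> [set` C] `<=` \bigcup_(f in [set` s]) branch f ->
  (size C <= size s)%N.
Proof.
move=> [uC aC] Cs.
have /choice[h hP] : forall x, exists f, x \in C -> f \in s /\ branch f x.
  move=> x; have [/Cs[f fs fx]|xC] := boolP (x \in C).
    by exists f.
  by exists (through x).
rewrite -(size_map h); apply: uniq_leq_size.
  rewrite map_inj_in_uniq // => x y xC yC hxy; apply: aC => //.
  exists (h x); split; first by have [] := hP x xC.
  by rewrite hxy; have [] := hP y yC.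
by move=> _ /mapP[x xC ->]; have [] := hP x xC.
Qed.

(** A neighbourhood of p omits only points of a compact K, which finitely many branches cover; an
    antichain with more points than these branches must leave K. *)
Lemma antichains_Omega (A : set opc) :
  (forall n, exists C : seq omega_tree,
    [/\ antichain C, size C = n & [set Some x | x in [set` C]] `<=` A]) ->
  Omega (None : opc) A.
Proof.
move=> hA U [K [cK clK] KU]; apply: contrapT => AU.
have [s Ks] := compact_branch_coverable cK.
have [C [aC sC CA]] := hA (size s).+1.
suff : (size C <= size s)%N by rewrite sC ltnn.
apply: leq_size_antichain => // x xC; apply: Ks; apply: contrapT => Kx.
apply: AU; exists (Some x); split; first by apply: CA; exists x.
by apply: KU; left; exists x.
Qed.

Lemma antichain_cons (C : seq omega_tree) (x : omega_tree) :
  antichain C -> (forall c, c \in C -> ~ comparable x c) ->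
  antichain (x :: C).
Proof.
move=> [uC aC] xC; split.
  rewrite /= uC andbT; apply/negP => /xC; apply; exact: comparable_refl.
move=> y z; rewrite !inE => /predU1P[->|yC] /predU1P[->|zC] //.
- by move/(xC _ zC).
- by move/comparable_sym/(xC _ yC).
- exact: aC.
Qed.

Lemma antichain_extend (C : seq omega_tree) (A : set omega_tree) :
  antichain C -> ~ branch_coverable A ->
  exists x y D, [/\ A x, A y, {subset D <= x :: y :: C}, antichain D &
    size D = (size C).+1].
Proof.
move=> aC nA; have [uC aCP] := aC; apply: contrapT => noD; apply: nA.
have cmpA x : A x -> exists2 c, c \in C & comparable x c.
  (* One new point suffices here, so x fills both places. *)
  move=> Ax; apply: contrapT => nc; apply: noD; exists x, x, (x :: C).
  split=> //; first by move=> y; rewrite !inE => /orP[->//|->]; rewrite !orbT.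
  by apply: antichain_cons => // c cC xc; apply: nc; exists c.
have chA c : c \in C -> forall x y, A x /\ below c x -> A y /\ below c y ->
    comparable x y.
  move=> cC x y [Ax cx] [Ay cy]; apply: contrapT => nxy; apply: noD.
  exists x, y, (x :: y :: rem c C); split=> //.
  - move=> z; rewrite !inE => /or3P[->|->|/mem_rem ->]; by rewrite ?orbT.
  (* If some z above c is comparable with d in C, then so is c, which forces d = c. *)
  - have incmp z : below c z -> forall d, d \in rem c C -> ~ comparable z d.
      move=> cz d; rewrite mem_rem_uniq // inE => /andP[dc dC].
      move=> /(comparable_belowW cz)/(aCP _ _ cC dC) cd.
      by rewrite cd eqxx in dc.
    apply: antichain_cons => [|d]; last first.
      by rewrite inE => /predU1P[->//|]; exact: incmp.
    apply: antichain_cons => [|d]; last exact: incmp.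
    split; first exact: rem_uniq.
    by move=> a b /mem_rem aC' /mem_rem; exact: aCP.
  - by rewrite /= size_rem //; case: (C) cC.
have /choice[h hP] : forall c, exists f, c \in C ->
    [set x | A x /\ below c x] `<=` branch f.
  move=> c; have [cC|cC] := boolP (c \in C).
    by have [f fP] := chain_sub_branch (chA c cC); exists f.
  by exists (through c).
exists ([seq through c | c <- C] ++ [seq h c | c <- C]) => x Ax.
have [c cC /comparable_below[xc|cx]] := cmpA x Ax.
  exists (through c); last exact/xc/branch_through.
  by rewrite /= mem_cat map_f.
exists (h c); last exact: hP.
by rewrite /= mem_cat map_f ?orbT.
Qed.

(** * The strategy of Two *)

Lemma set2_card_le (T : Type) (a b : T) : [set a; b] #<= `I_2.
Proof.
suff -> : [set a; b] = (fun n => if n is 0 then a else b) @` `I_2.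
  exact: card_image_le.
apply/seteqP; split=> [x [->|->]|x [[|n] _ <-]].
- by exists 0.
- by exists 1.
- by left.
- by right.
Qed.

(** The pair r holds the answer of Two and the next antichain. Selecting p already puts the union in
    [Omega], so in that case the antichain may stop growing. *)
Definition good_answer (C : seq omega_tree) (A : set opc)
    (r : set opc * seq omega_tree) : Prop :=
  [/\ r.1 `<=` A, r.1 #<= `I_2, antichain r.2,
      [set Some x | x in [set` r.2]] `<=`
        r.1 `|` [set Some x | x in [set` C]] &
      r.1 None \/ size r.2 = (size C).+1].

Lemma good_answer_ex (C : seq omega_tree) (A : set opc) :
  antichain C -> Omega (None : opc) A -> exists r, good_answer C A r.
Proof.
move=> aC oA; have [AN|AN] := pselect (A None).
  exists ([set None], C); split=> //=; last by left.
  - by move=> _ ->.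
  - by rewrite -[X in X #<= _]setUid; exact: set2_card_le.
have [x [y [D [Ax Ay DC aD sD]]]] :=
  antichain_extend aC (contra_not (Omega_branch_coverable oA) AN).
exists ([set Some x; Some y], D); split=> //=; last by right.
- by move=> _ [->|->].
- exact: set2_card_le.
- move=> _ [z /DC + <-]; rewrite !inE => /or3P[/eqP->|/eqP->|zC].
  + by left; left.
  + by left; right.
  + by right; exists z.
Qed.

Theorem proposition2p12 :
  two_has_winning_strategy 2
    (Omega (None : one_point_compactification omega_tree))
    (Omega (None : one_point_compactification omega_tree)).
Proof.
have /choice[step stepP] : forall q : seq omega_tree * set opc, exists r,
    antichain q.1 -> Omega (None : opc) q.2 -> good_answer q.1 q.2 r.
  move=> q; have [[aC oA]|h] :=
      pselect (antichain q.1 /\ Omega (None : opc) q.2).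
    by have [r] := good_answer_ex aC oA; exists r.
  by exists (set0, [::]) => aC oA; case: h.
pose state := foldl (fun C A => (step (C, A)).2) [::].
(* Two recovers the current antichain by replaying all moves but the last, then answers the last.
   The default [set0] never arises, since s is nonempty in a run. *)
exists (fun s => (step (state (take (size s).-1 s), last set0 s)).1) => A oA.
pose C n := state (mkseq A n).
set sigma := (sigma in two_answer sigma).
have answerE n : two_answer sigma A n = (step (C n, A n)).1.
  rewrite /two_answer /sigma mkseqS last_rcons size_rcons -cats1.
  by rewrite take_size_cat.
have CS n : C n.+1 = (step (C n, A n)).2.
  by rewrite /C /state mkseqS -cats1 foldl_cat.
have aC n : antichain (C n).
  elim: n => [|n ih]; first by split.
  by rewrite CS; have [] := stepP (C n, A n) ih (oA n).
have goodC n : good_answer (C n) (A n) (step (C n, A n)).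
  exact: stepP (C n, A n) (aC n) (oA n).
split=> [n|]; first by rewrite answerE; have [] := goodC n.
have [[n FN]|nFN] := pselect (exists n, two_answer sigma A n None).
  by apply: subset_closure; exists n.
apply: antichains_Omega => n; exists (C n); split=> //.
  elim: n => // n ih; rewrite CS.
  have [_ _ _ _ [FN|->]] := goodC n; last by rewrite ih.
  by case: nFN; exists n; rewrite answerE.
(* Every point that enters the antichain in inning n comes from the answer of that inning. *)
elim: n => [_ [x]//|n ih] x; rewrite CS.
have [_ _ _ sub _] := goodC n.
by move=> /sub[Fx|/ih//]; exists n => //; rewrite answerE.
Qed.
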